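(* Let $K$ be a field and let $(A,\prec,\succ,\Delta_\prec,\Delta_\succ)$ be a bidendriform bialgebra over $K$ which is connected as a dendriform coalgebra. Then $A$ is generated, as a dendriform algebra, by the subspace $Prim_{tot}(A)=\{a\in A : \Delta_\prec(a)=\Delta_\succ(a)=0\}$ of its totally primitive elements (that is, the smallest subspace of $A$ containing $Prim_{tot}(A)$ and stable under $\prec$ and $\succ$ is $A$).
   Context: $K$ is a field of any characteristic. A dendriform algebra is a $K$-vector space $A$ with linear maps $\prec,\succ:A\otimes A\to A$ such that for all $a,b,c\in A$: $(a\prec b)\prec c=a\prec(b\prec c+b\succ c)$, $(a\succ b)\prec c=a\succ(b\prec c)$, $(a\prec b+a\succ b)\succ c=a\succ(b\succ c)$. One writes $ab=a\prec b+a\succ b$, an associative (non-unital) product. A dendriform coalgebra is a $K$-vector space $C$ with linear maps $\Delta_\prec,\Delta_\succ:C\to C\otimes C$ such that, with $\tilde\Delta=\Delta_\prec+\Delta_\succ$: $(\Delta_\prec\otimes Id)\Delta_\prec=(Id\otimes\tilde\Delta)\Delta_\prec$, $(\Delta_\succ\otimes Id)\Delta_\prec=(Id\otimes\Delta_\prec)\Delta_\succ$, $(\tilde\Delta\otimes Id)\Delta_\succ=(Id\otimes\Delta_\succ)\Delta_\succ$. Sweedler-type notation (sums implicit): $\Delta_\prec(a)=a'_\prec\otimes a''_\prec$, $\Delta_\succ(a)=a'_\succ\otimes a''_\succ$, $\tilde\Delta(a)=a'\otimes a''$. A bidendriform bialgebra is $(A,\prec,\succ,\Delta_\prec,\Delta_\succ)$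 such that $(A,\prec,\succ)$ is a dendriform algebra, $(A,\Delta_\prec,\Delta_\succ)$ is a dendriform coalgebra, and for all $a,b\in A$: $\Delta_\succ(a\succ b)=a'b'_\succ\otimes a''\succ b''_\succ+a'\otimes a''\succ b+b'_\succ\otimes a\succ b''_\succ+ab'_\succ\otimes b''_\succ+a\otimes b$; $\Delta_\succ(a\prec b)=a'b'_\succ\otimes a''\prec b''_\succ+a'\otimes a''\prec b+b'_\succ\otimes a\prec b''_\succ$; $\Delta_\prec(a\succ b)=a'b'_\prec\otimes a''\succ b''_\prec+ab'_\prec\otimes b''_\prec+b'_\prec\otimes a\succ b''_\prec$; $\Delta_\prec(a\prec b)=a'b'_\prec\otimes a''\prec b''_\prec+a'b\otimes a''+b'_\prec\otimes a\prec b''_\prec+b\otimes a$. Connectedness: for a dendriform coalgebra $C$ put $\mathcal P_C(0)=\{Id_C\}$ and, for $n\ge1$, let $\mathcal P_C(n)$ be the set of maps $C\to C^{\otimes(n+1)}$ of the form $(Id^{\otimes(i-1)}\otimes\delta\otimes Id^{\otimes(n-i)})\circ P$ with $P\in\mathcal P_C(n-1)$, $1\le i\le n$, $\delta\in\{\Delta_\prec,\Delta_\succ\}$. $C$ is connected if for every $a\in C$ there is $n_a\in\mathbb N$ with $P(a)=0$ for all $P\in\mathcal P_C(n_a)$. *)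

(* Defs.v *)
From HB Require Import structures.
From mathcomp Require Import all_boot all_algebra sesquilinear.
From mathcomp Require Import boolp classical_sets.
Set Implicit Arguments.
Unset Strict Implicit.
Unset Printing Implicit Defensive.
Import GRing.Theory.
Local Open Scope classical_set_scope.
Local Open Scope ring_scope.
Local Open Scope quotient_scope.

(* The tensor product of two vector spaces of arbitrary dimension: a finite
   sequence of pairs (u_i, v_i) stands for the sum of the u_i (x) v_i, and
   [tensor_rel] is the congruence generated by commutativity of the sum and the
   bilinearity relations.  No scalars are needed in the sequences, since
   c (u (x) v) = (c u) (x) v. *)
Section TensorProduct.
Variables (K : fieldType) (U V : lmodType K).
Implicit Types s t : seq (U * V).

Inductive tensor_rel : seq (U * V) -> seq (U * V) -> Prop :=
| tensor_rel_refl s : tensor_rel s s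
| tensor_rel_sym s t : tensor_rel s t -> tensor_rel t s
| tensor_rel_trans s t r : tensor_rel s t -> tensor_rel t r -> tensor_rel s r
| tensor_rel_cat s s' t t' :
    tensor_rel s s' -> tensor_rel t t' -> tensor_rel (s ++ t) (s' ++ t')
| tensor_rel_catC s t : tensor_rel (s ++ t) (t ++ s)
| tensor_rel0 v : tensor_rel [:: (0, v)] [::]
| tensor_relDl u u' v : tensor_rel [:: (u + u', v)] [:: (u, v); (u', v)]
| tensor_relDr u v v' : tensor_rel [:: (u, v + v')] [:: (u, v); (u, v')]
| tensor_relZ (c : K) u v : tensor_rel [:: (c *: u, v)] [:: (u, c *: v)].

Definition tensor_relb s t : bool := `[< tensor_rel s t >].

Lemma tensor_relb_refl : reflexive tensor_relb.
Proof. by move=> s; apply/asboolP; exact: tensor_rel_refl. Qed.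

Lemma tensor_relb_sym : symmetric tensor_relb.
Proof.
by move=> s t; apply/idP/idP => /asboolP st; apply/asboolP;
  exact: tensor_rel_sym.
Qed.

Lemma tensor_relb_trans : transitive tensor_relb.
Proof.
move=> t s r /asboolP st /asboolP tr; apply/asboolP.
exact: tensor_rel_trans st tr.
Qed.

Canonical tensor_equiv :=
  EquivRel tensor_relb tensor_relb_refl tensor_relb_sym tensor_relb_trans.

Definition tensor := {eq_quot tensor_equiv}.

HB.instance Definition _ := Choice.on tensor.
HB.instance Definition _ := EqQuotient.on tensor.

Lemma tensor_eqP s t : (\pi_tensor s = \pi_tensor t) <-> tensor_rel s t.
Proof.
split=> [/eqP|st]; first by rewrite piE => /asboolP.
by apply/eqP; rewrite piE; exact/asboolP.
Qed.

Lemma tensor_reprP s : tensor_rel (repr (\pi_tensor s)) s.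
Proof. by apply/tensor_eqP; rewrite reprK. Qed.

Let scl (c : K) s : seq (U * V) := [seq (c *: p.1, p.2) | p <- s].

Lemma tensor_rel_scale c s t :
  tensor_rel s t -> tensor_rel (scl c s) (scl c t).
Proof.
elim=> {s t} [s|s t _ st|s t r _ st _ tr|s s' t t' _ ss _ tt|s t|v|u u' v
  |u v v'|d u v] /=.
- exact: tensor_rel_refl.
- exact: tensor_rel_sym.
- exact: tensor_rel_trans st tr.
- by rewrite /scl !map_cat; exact: tensor_rel_cat.
- by rewrite /scl !map_cat; exact: tensor_rel_catC.
- by rewrite scaler0; exact: tensor_rel0.
- by rewrite scalerDr; exact: tensor_relDl.
- exact: tensor_relDr.
- by rewrite scalerA mulrC -scalerA; exact: tensor_relZ.
Qed.

Definition tensor_zero : tensor := \pi_tensor [::].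
Definition tensor_add (x y : tensor) : tensor := \pi_tensor (repr x ++ repr y).
Definition tensor_scale (c : K) (x : tensor) : tensor :=
  \pi_tensor [seq (c *: p.1, p.2) | p <- repr x].
Definition tensor_opp (x : tensor) : tensor := tensor_scale (-1) x.

Let add_pi s t : tensor_add (\pi_tensor s) (\pi_tensor t) = \pi_tensor (s ++ t).
Proof. by apply/tensor_eqP; apply: tensor_rel_cat; exact: tensor_reprP. Qed.

Let scale_pi c s : tensor_scale c (\pi_tensor s) = \pi_tensor (scl c s).
Proof. by apply/tensor_eqP; apply: tensor_rel_scale; exact: tensor_reprP. Qed.

Let addA : associative tensor_add.
Proof.
move=> x y z; rewrite -[x]reprK -[y]reprK -[z]reprK.
rewrite (add_pi (repr y)) (add_pi (repr x) (repr y)).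
by rewrite (add_pi (repr x)) (add_pi _ (repr z)) catA.
Qed.

Let addC : commutative tensor_add.
Proof.
move=> x y; rewrite -[x]reprK -[y]reprK.
rewrite (add_pi (repr x)) (add_pi (repr y)).
by apply/tensor_eqP; exact: tensor_rel_catC.
Qed.

Let add0 : left_id tensor_zero tensor_add.
Proof. by move=> x; rewrite -[x]reprK /tensor_zero add_pi. Qed.

Let scaleDl x c d :
  tensor_scale (c + d) x = tensor_add (tensor_scale c x) (tensor_scale d x).
Proof.
rewrite -[x]reprK !scale_pi add_pi; apply/tensor_eqP.
elim: (repr x) => [|p s IHs] /=; first exact: tensor_rel_refl.
rewrite scalerDl -cat1s.
apply: tensor_rel_trans (tensor_rel_cat (tensor_relDl _ _ _) IHs) _ => /=.
rewrite -[X in tensor_rel X _]cat1s -[X in tensor_rel _ X]cat1s.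
apply: tensor_rel_cat; first exact: tensor_rel_refl.
rewrite -cat1s catA -[in X in tensor_rel _ X]cat1s [X in tensor_rel _ X]catA.
by apply: tensor_rel_cat; [exact: tensor_rel_catC|exact: tensor_rel_refl].
Qed.

Let scale1 : left_id 1 tensor_scale.
Proof.
move=> x; rewrite -[x]reprK scale_pi; congr \pi_tensor.
by rewrite -[RHS]map_id; apply: eq_map => -[u v]; rewrite scale1r.
Qed.

Let scale0 x : tensor_scale 0 x = tensor_zero.
Proof.
rewrite -[x]reprK scale_pi; apply/tensor_eqP.
elim: (repr x) => [|p s IHs] /=; first exact: tensor_rel_refl.
by rewrite scale0r -cat1s; exact: tensor_rel_cat (tensor_rel0 _) IHs.
Qed.

Let addN : left_inverse tensor_zero tensor_opp tensor_add.
Proof.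
by move=> x; rewrite -{2}[x]scale1 -scaleDl addNr scale0.
Qed.

HB.instance Definition _ := GRing.isZmodule.Build tensor addA addC add0 addN.

Let scaleA c d x : tensor_scale c (tensor_scale d x) = tensor_scale (c * d) x.
Proof.
rewrite -[x]reprK (scale_pi _ (repr x)) scale_pi (scale_pi _ (repr x)).
congr \pi_tensor; rewrite /scl -map_comp.
by apply: eq_map => -[u v] /=; rewrite scalerA.
Qed.

Let scaleDr : right_distributive tensor_scale +%R.
Proof.
move=> c x y; rewrite -[x]reprK -[y]reprK /GRing.add /=.
rewrite (add_pi (repr x)) !(scale_pi _ (repr _)) scale_pi add_pi.
by rewrite /scl map_cat.
Qed.

HB.instance Definition _ := GRing.Zmodule_isLmodule.Build K tensor
  scaleA scale1 scaleDr (fun x c d => scaleDl x c d).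

Lemma tensor_piD s t :
  \pi_tensor s + \pi_tensor t = \pi_tensor (s ++ t).
Proof. exact: add_pi. Qed.

Lemma tensor_piZ (c : K) s :
  c *: (\pi_tensor s : tensor) = \pi_tensor [seq (c *: p.1, p.2) | p <- s].
Proof. exact: scale_pi. Qed.

Definition tens (u : U) (v : V) : tensor := \pi_tensor [:: (u, v)].

Fact tens_is_bilinear : bilinear_for *:%R *:%R tens.
Proof.
split=> [v c u u'|u c v v'] /=; rewrite tensor_piZ tensor_piD.
  by apply/tensor_eqP; exact: tensor_relDl.
apply/tensor_eqP; apply: tensor_rel_trans (tensor_relDr _ _ _) _ => /=.
rewrite -cat1s -[X in tensor_rel _ X]cat1s.
apply: tensor_rel_cat; last exact: tensor_rel_refl.
exact/tensor_rel_sym/tensor_relZ.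
Qed.

HB.instance Definition _ := bilinear_isBilinear.Build K U V tensor *:%R *:%R
  tens tens_is_bilinear.

Lemma tensorE (x : tensor) : x = \sum_(p <- repr x) tens p.1 p.2.
Proof.
rewrite -[LHS]reprK; elim: (repr x) => [|[u v] s IHs].
  by rewrite big_nil.
by rewrite big_cons -IHs tensor_piD.
Qed.

(* Implicit summation over a tensor: if x is the sum of the u_i (x) v_i, then
   [tlift f x] is the sum of the f u_i v_i.  It is independent of the chosen
   decomposition of x, and linear in x, as soon as f is bilinear. *)
Definition tlift (W : lmodType K) (f : U -> V -> W) (x : tensor) : W :=
  \sum_(p <- repr x) f p.1 p.2.

Section UniversalProperty.
Variables (W : lmodType K) (f : {bilinear U -> V -> W}).

Lemma tensor_rel_lift s t : tensor_rel s t ->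
  \sum_(p <- s) f p.1 p.2 = \sum_(p <- t) f p.1 p.2.
Proof.
elim=> {s t} [s|s t _ st|s t r _ st _ tr|s s' t t' _ ss _ tt|s t|v|u u' v
  |u v v'|c u v] //=.
- by rewrite st.
- by rewrite !big_cat /= ss tt.
- by rewrite !big_cat /= addrC.
- by rewrite big_seq1 big_nil /= linear0l.
- by rewrite !big_cons big_nil /= linearDl /= !addr0.
- by rewrite !big_cons big_nil /= linearDr /= !addr0.
- by rewrite !big_seq1 /= linearZl_LR linearZr_LR.
Qed.

Lemma tlift_pi s : tlift f (\pi_tensor s) = \sum_(p <- s) f p.1 p.2.
Proof. exact: tensor_rel_lift (tensor_reprP s). Qed.

Fact tlift_is_linear : linear (tlift f).
Proof.
move=> c x y; rewrite -[x]reprK -[y]reprK tensor_piZ tensor_piD !tlift_pi.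
rewrite big_cat big_map /= scaler_sumr; congr (_ + _).
by apply: eq_bigr => p _; rewrite linearZl_LR.
Qed.

HB.instance Definition _ :=
  GRing.isLinear.Build K tensor W *:%R (tlift f) tlift_is_linear.

Lemma tlift_tens u v : tlift f (tens u v) = f u v.
Proof. by rewrite tlift_pi big_seq1. Qed.

Lemma tlift_unique (g : {linear tensor -> W}) :
  (forall u v, g (tens u v) = f u v) -> g =1 tlift f.
Proof.
move=> gE x; rewrite {1}[x]tensorE linear_sum.
by apply: eq_bigr => p _; rewrite gE.
Qed.

End UniversalProperty.

Section UnbundledLift.
Variables (W : lmodType K) (f : U -> V -> W).
Hypothesis fP : bilinear_for *:%R *:%R f.

Let bf : {bilinear U -> V -> W} :=
  HB.pack f (bilinear_isBilinear.Build K U V W *:%R *:%R f fP).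

Lemma bilinear_tlift_linear : linear (tlift f).
Proof. exact: (tlift_is_linear bf). Qed.

Lemma bilinear_tlift_tens u v : tlift f (tens u v) = f u v.
Proof. exact: (tlift_tens bf). Qed.

End UnbundledLift.
End TensorProduct.

Notation "u ⊗ v" := (tens u v) (at level 40, left associativity) : ring_scope.
Notation "\tsum_ ( u , v <- x ) F" := (tlift (fun u v => F) x)
  (at level 36, u name, v name, x at level 50, F at level 40,
   format "\tsum_ ( u ,  v  <-  x )  F") : ring_scope.

Section TensorMaps.
Variable K : fieldType.

Section Map.
Variables (U V U' V' : lmodType K).
Variables (f : {linear U -> U'}) (g : {linear V -> V'}).

Definition tmap_fun (u : U) (v : V) : tensor U' V' := f u ⊗ g v.

Fact tmap_fun_is_bilinear : bilinear_for *:%R *:%R tmap_fun.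
Proof.
split=> [v c u u'|u c v v'] /=; rewrite /tmap_fun linearP.
  by rewrite linearPl.
by rewrite linearPr.
Qed.

HB.instance Definition _ := bilinear_isBilinear.Build K U V (tensor U' V')
  *:%R *:%R tmap_fun tmap_fun_is_bilinear.

(* The linear map f (x) g. *)
Definition tmap : tensor U V -> tensor U' V' := tlift tmap_fun.

HB.instance Definition _ := GRing.Linear.on tmap.

Lemma tmap_tens u v : tmap (u ⊗ v) = f u ⊗ g v.
Proof. exact: tlift_tens. Qed.

End Map.

Section Assoc.
Variables (U V W : lmodType K).

Definition tassoc3 (w : W) (u : U) (v : V) : tensor U (tensor V W) :=
  u ⊗ (v ⊗ w).

Fact tassoc3_is_bilinear w : bilinear_for *:%R *:%R (tassoc3 w).
Proof.
split=> [v c u u'|u c v v'] /=; rewrite /tassoc3; first by rewrite linearPl.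
by rewrite linearPl linearPr.
Qed.

HB.instance Definition _ w := bilinear_isBilinear.Build K U V
  (tensor U (tensor V W)) *:%R *:%R (tassoc3 w) (tassoc3_is_bilinear w).

Definition tassoc2 (x : tensor U V) (w : W) : tensor U (tensor V W) :=
  tlift (tassoc3 w) x.

Fact tassoc2_is_bilinear : bilinear_for *:%R *:%R tassoc2.
Proof.
split=> [w|x c w w'] /=; first exact: tlift_is_linear.
rewrite /tassoc2 /tlift scaler_sumr -big_split; apply: eq_bigr => p _ /=.
by rewrite /tassoc3 !linearPr.
Qed.

HB.instance Definition _ := bilinear_isBilinear.Build K (tensor U V) W
  (tensor U (tensor V W)) *:%R *:%R tassoc2 tassoc2_is_bilinear.

(* The canonical identification (U (x) V) (x) W -> U (x) (V (x) W). *)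
Definition tassoc : tensor (tensor U V) W -> tensor U (tensor V W) :=
  tlift tassoc2.

HB.instance Definition _ := GRing.Linear.on tassoc.

Lemma tassoc_tens u v w : tassoc (u ⊗ v ⊗ w) = u ⊗ (v ⊗ w).
Proof. by rewrite /tassoc tlift_tens /= /tassoc2 tlift_tens. Qed.

End Assoc.

(* [tpow C n] is the (n+1)-st tensor power of C, bracketed to the right. *)
Fixpoint tpow (C : lmodType K) (n : nat) : lmodType K :=
  if n is n'.+1 then tensor C (tpow C n') else C.

(* [tinsert delta n i] applies delta to the factor of index i, counted from 0,
   of the (n+1)-st tensor power, that is, it is
   Id^{(x) i} (x) delta (x) Id^{(x) (n - i)}; only i <= n is meaningful. *)
Fixpoint tinsert (C : lmodType K) (delta : {linear C -> tensor C C})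
    (n i : nat) {struct n} : {linear tpow C n -> tpow C n.+1} :=
  match n, i with
  | 0, _ => delta
  | n'.+1, 0 => tassoc (U := C) (V := C) (W := tpow C n')
                  \o tmap delta (idfun : {linear tpow C n' -> tpow C n'})
  | n'.+1, i'.+1 => tmap (idfun : {linear C -> C}) (tinsert delta n' i')
  end.

End TensorMaps.

Section Dendriform.
Variable K : fieldType.

Record dendriform_algebra (A : lmodType K)
    (prec succ : {bilinear A -> A -> A}) : Prop := {
  dend_prec_prec a b c : prec (prec a b) c = prec a (prec b c + succ b c);
  dend_succ_prec a b c : prec (succ a b) c = succ a (prec b c);
  dend_succ_succ a b c : succ (prec a b + succ a b) c = succ a (succ b c)
}.

Record dendriform_coalgebra (C : lmodType K)
    (Dprec Dsucc : {linear C -> tensor C C}) : Prop := {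
  codend_prec_prec c : tassoc (tmap Dprec idfun (Dprec c)) =
                       tmap idfun (Dprec \+ Dsucc) (Dprec c);
  codend_succ_prec c : tassoc (tmap Dsucc idfun (Dprec c)) =
                       tmap idfun Dprec (Dsucc c);
  codend_succ_succ c : tassoc (tmap (Dprec \+ Dsucc) idfun (Dsucc c)) =
                       tmap idfun Dsucc (Dsucc c)
}.

Record bidendriform_bialgebra (A : lmodType K)
    (prec succ : {bilinear A -> A -> A})
    (Dprec Dsucc : {linear A -> tensor A A}) : Prop := {
  bidend_algebra : dendriform_algebra prec succ;
  bidend_coalgebra : dendriform_coalgebra Dprec Dsucc;
  bidend_Dsucc_succ a b (mul := fun x y => prec x y + succ x y)
      (D := fun x => Dprec x + Dsucc x) :
    Dsucc (succ a b) =
      \tsum_(a1, a2 <- D a) \tsum_(b1, b2 <- Dsucc b) (mul a1 b1 ⊗ succ a2 b2)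
      + \tsum_(a1, a2 <- D a) (a1 ⊗ succ a2 b)
      + \tsum_(b1, b2 <- Dsucc b) (b1 ⊗ succ a b2)
      + \tsum_(b1, b2 <- Dsucc b) (mul a b1 ⊗ b2)
      + a ⊗ b;
  bidend_Dsucc_prec a b (mul := fun x y => prec x y + succ x y)
      (D := fun x => Dprec x + Dsucc x) :
    Dsucc (prec a b) =
      \tsum_(a1, a2 <- D a) \tsum_(b1, b2 <- Dsucc b) (mul a1 b1 ⊗ prec a2 b2)
      + \tsum_(a1, a2 <- D a) (a1 ⊗ prec a2 b)
      + \tsum_(b1, b2 <- Dsucc b) (b1 ⊗ prec a b2);
  bidend_Dprec_succ a b (mul := fun x y => prec x y + succ x y)
      (D := fun x => Dprec x + Dsucc x) :
    Dprec (succ a b) =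
      \tsum_(a1, a2 <- D a) \tsum_(b1, b2 <- Dprec b) (mul a1 b1 ⊗ succ a2 b2)
      + \tsum_(b1, b2 <- Dprec b) (mul a b1 ⊗ b2)
      + \tsum_(b1, b2 <- Dprec b) (b1 ⊗ succ a b2);
  bidend_Dprec_prec a b (mul := fun x y => prec x y + succ x y)
      (D := fun x => Dprec x + Dsucc x) :
    Dprec (prec a b) =
      \tsum_(a1, a2 <- D a) \tsum_(b1, b2 <- Dprec b) (mul a1 b1 ⊗ prec a2 b2)
      + \tsum_(a1, a2 <- D a) (mul a1 b ⊗ a2)
      + \tsum_(b1, b2 <- Dprec b) (b1 ⊗ prec a b2)
      + b ⊗ a
}.

Fixpoint iterated_coproducts (C : lmodType K)
    (Dprec Dsucc : {linear C -> tensor C C}) (n : nat) : set (C -> tpow C n) :=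
  match n return set (C -> tpow C n) with
  | 0 => [set idfun]
  | n'.+1 => [set Q | exists (P : C -> tpow C n') (i : 'I_n'.+1)
                            (delta : {linear C -> tensor C C}),
      [/\ @iterated_coproducts C Dprec Dsucc n' P,
          delta = Dprec \/ delta = Dsucc &
          Q = tinsert delta n' i \o P]]
  end.
Arguments iterated_coproducts {C} Dprec Dsucc n _.

Definition dendriform_connected (C : lmodType K)
    (Dprec Dsucc : {linear C -> tensor C C}) : Prop :=
  forall a : C, exists n : nat, forall P : C -> tpow C n,
    iterated_coproducts Dprec Dsucc n P -> P a = 0.

Definition prim_tot (C : lmodType K) (Dprec Dsucc : {linear C -> tensor C C}) :
  set C := [set a | Dprec a = 0 /\ Dsucc a = 0].

Record dendriform_subalgebra (A : lmodType K)
    (prec succ : {bilinear A -> A -> A}) (S : set A) : Prop := {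
  dendsub0 : S 0;
  dendsubP (c : K) a b : S a -> S b -> S (c *: a + b);
  dendsub_prec a b : S a -> S b -> S (prec a b);
  dendsub_succ a b : S a -> S b -> S (succ a b)
}.

End Dendriform.

(* Main.v *)
Require Import Defs.
From HB Require Import structures.
From mathcomp Require Import all_boot all_algebra sesquilinear zify.
From mathcomp Require Import boolp classical_sets.
Set Implicit Arguments.
Unset Strict Implicit.
Unset Printing Implicit Defensive.
Import GRing.Theory.
Local Open Scope ring_scope.

(** Write D for the total coproduct Dprec + Dsucc and use Sweedler notation.
    The proof exhibits every element a in the form

      a = theta(a) + a'_succ ≻ theta(a''_succ) + pi(a''_prec) ≺ a'_prec   (1)

    where theta takes its values in the totally primitive elements and pi takes
    its values in the kernel of D.  The three maps involved are linear:

    - pi is the solution of pi(a) = a - pi(a'') ≺ a' ([prim_projection]).  For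
      p in ker D one has D(p ≺ b) = b ⊗ p + b' ⊗ (p ≺ b''), which together with
      coassociativity makes D pi vanish.
    - e(a) = a - pi(a''_prec) ≺ a'_prec takes its values in ker Dprec, and it is
      a morphism for the left coaction, Dsucc e = (Id ⊗ e) Dsucc
      ([Dprec_projection]).
    - theta is the solution of theta(a) = e(a) - a'_succ ≻ theta(a''_succ)
      ([prim_tot_projection]).  The kernel of Dprec is a Hopf module over A for
      the action ≻ and the coaction Dsucc, and theta is e followed by the usual
      projection onto the coinvariants, which are the totally primitive
      elements.

    Substituting the last two definitions in each other gives (1).

    Connectedness enters through the linear maps that factor through n-fold
    coproducts ([through_coproducts]): convolving such a map, on either side,
    produces a map that factors through (n+1)-fold coproducts, and each element
    is killed by such maps for n large.  Hence a recursion
    T(a) = g(a) - m(a', T(a'')) can be solved ([convolution_exists]), and its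
    homogeneous version has the zero solution only ([convolution_unique]); the
    latter yields all the vanishing statements above.

    Finally, (1) and the equation of pi express a and pi(a) by elements of
    Prim_tot and by the values of Id and pi at the tensor factors of the
    coproducts of a.  Iterating n times gives maps Phi_n and psi_n with values
    in any subalgebra containing Prim_tot, such that Id - Phi_n and pi - psi_n
    factor through n-fold coproducts ([subalgebra_approximation]).  If the
    n-fold coproducts of a vanish then a = Phi_n(a). *)

(** * Tensor products *)

Section TensorFacts.
Variable K : fieldType.
Implicit Types U V W X : lmodType K.

Lemma tensor_ext U V W (f g : {linear tensor U V -> W}) :
  (forall u v, f (u ⊗ v) = g (u ⊗ v)) -> f =1 g.
Proof. by move=> fg x; rewrite [x]tensorE !linear_sum; apply: eq_bigr. Qed.

Lemma tmap_comp U V U1 V1 U2 V2 (f : {linear U1 -> U2}) (g : {linear V1 -> V2})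
    (f1 : {linear U -> U1}) (g1 : {linear V -> V1}) x :
  tmap f g (tmap f1 g1 x) = tmap (f \o f1) (g \o g1) x.
Proof.
move: x; apply: (tensor_ext (f := tmap f g \o tmap f1 g1)
  (g := tmap (f \o f1) (g \o g1))) => u v.
change (tmap f g (tmap f1 g1 (u ⊗ v)) = tmap (f \o f1) (g \o g1) (u ⊗ v)).
by rewrite !tmap_tens.
Qed.

Lemma tmap_ext U V U1 V1 (f f1 : {linear U -> U1}) (g g1 : {linear V -> V1}) :
  f =1 f1 -> g =1 g1 -> tmap f g =1 tmap f1 g1.
Proof.
by move=> ff1 gg1 x; apply: eq_bigr => p _; rewrite /tmap_fun ff1 gg1.
Qed.

Lemma tmap_id U V :
  tmap (idfun : {linear U -> U}) (idfun : {linear V -> V}) =1 id.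
Proof.
apply: (tensor_ext (f := tmap idfun idfun) (g := idfun)) => u v.
exact: (tmap_tens idfun idfun).
Qed.

Lemma tmap_compr U V V1 V2 (g : {linear V1 -> V2}) (g1 : {linear V -> V1}) x :
  tmap (idfun : {linear U -> U}) g (tmap idfun g1 x) = tmap idfun (g \o g1) x.
Proof. by rewrite tmap_comp; apply: tmap_ext. Qed.

Lemma tmap_compl V U U1 U2 (f : {linear U1 -> U2}) (f1 : {linear U -> U1}) x :
  tmap f (idfun : {linear V -> V}) (tmap f1 idfun x) = tmap (f \o f1) idfun x.
Proof. by rewrite tmap_comp; apply: tmap_ext. Qed.

Lemma tlift_id U V (x : tensor U V) : \tsum_(u, v <- x) (u ⊗ v) = x.
Proof. by rewrite -[RHS]tmap_id. Qed.

(** Repackages [tlift f] as a linear map, for an f whose bilinearity is known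
    from a proof rather than from a canonical structure. *)
Definition tlin U V W (f : U -> V -> W) (fP : bilinear_for *:%R *:%R f) :
  {linear tensor U V -> W} :=
  HB.pack (tlift f) (GRing.isLinear.Build K (tensor U V) W *:%R (tlift f)
                       (bilinear_tlift_linear fP)).

Lemma tlift_comp U V W W1 (l : {linear W -> W1}) (f : U -> V -> W) x :
  l (tlift f x) = \tsum_(u, v <- x) (l (f u v)).
Proof. exact: linear_sum. Qed.

Lemma tlift_split U V W (f g : U -> V -> W) x :
  \tsum_(u, v <- x) (f u v + g u v) = tlift f x + tlift g x.
Proof. exact: big_split. Qed.

Lemma tlift_opp U V W (f : U -> V -> W) x :
  \tsum_(u, v <- x) (- f u v) = - tlift f x.
Proof. exact: sumrN. Qed.

Lemma tlift_sub U V W (f g : U -> V -> W) x :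
  \tsum_(u, v <- x) (f u v - g u v) = tlift f x - tlift g x.
Proof. exact: sumrB. Qed.

Lemma eq_tlift U V W (f g : U -> V -> W) x :
  (forall u v, f u v = g u v) -> tlift f x = tlift g x.
Proof. by move=> fg; apply: eq_bigr. Qed.

(** Rewrites iterated implicit sums in the form in which the coassociativity
    axioms are stated. *)
Lemma tlift_coassoc U V U1 V1 X (d : {linear U -> tensor U1 V1})
    (h : {linear tensor V1 V -> X}) (x : tensor U V) :
  \tsum_(u, v <- x) (\tsum_(u1, u2 <- d u) (u1 ⊗ h (u2 ⊗ v))) =
  tmap (idfun : {linear U1 -> U1}) h
    (tassoc (tmap d (idfun : {linear V -> V}) x)).
Proof.
transitivity (\tsum_(u, v <- x) tmap idfun h (tassoc (d u ⊗ v))); last first.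
  by rewrite -(tlift_comp (tmap idfun h \o @tassoc _ U1 V1 V)).
apply: eq_tlift => u v.
rewrite /tassoc tlift_tens /= /tassoc2 (tlift_comp (tmap idfun h)).
by apply: eq_tlift => u1 u2; apply/esym/(tmap_tens idfun h).
Qed.

Section AssocInverse.
Variables U V W : lmodType K.

Definition tassocl3 (u : U) (v : V) (w : W) : tensor (tensor U V) W :=
  u ⊗ v ⊗ w.

Fact tassocl3_is_bilinear u : bilinear_for *:%R *:%R (tassocl3 u).
Proof.
split=> [w c v v'|v c w w'] /=; rewrite /tassocl3; last by rewrite linearPr.
by rewrite linearPr linearPl.
Qed.

HB.instance Definition _ u := bilinear_isBilinear.Build K V W
  (tensor (tensor U V) W) *:%R *:%R (tassocl3 u) (tassocl3_is_bilinear u).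

Definition tassocl2 (u : U) (x : tensor V W) : tensor (tensor U V) W :=
  tlift (tassocl3 u) x.

Fact tassocl2_is_bilinear : bilinear_for *:%R *:%R tassocl2.
Proof.
split=> [x c u u'|u c x x'] /=; last exact: tlift_is_linear.
rewrite /tassocl2 /tlift scaler_sumr -big_split; apply: eq_bigr => p _ /=.
by rewrite /tassocl3 !linearPl.
Qed.

HB.instance Definition _ := bilinear_isBilinear.Build K U (tensor V W)
  (tensor (tensor U V) W) *:%R *:%R tassocl2 tassocl2_is_bilinear.

Definition tassocl : tensor U (tensor V W) -> tensor (tensor U V) W :=
  tlift tassocl2.

HB.instance Definition _ := GRing.Linear.on tassocl.

Lemma tassocl_tens u v w : tassocl (u ⊗ (v ⊗ w)) = u ⊗ v ⊗ w.
Proof. by rewrite /tassocl tlift_tens /= /tassocl2 tlift_tens. Qed.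

End AssocInverse.

Lemma tensor_ext3l U V W X (f g : {linear tensor (tensor U V) W -> X}) :
  (forall u v w, f (u ⊗ v ⊗ w) = g (u ⊗ v ⊗ w)) -> f =1 g.
Proof.
move=> fg; apply: tensor_ext => x w; rewrite [x]tensorE.
rewrite (linear_sumlz (@tens K (tensor U V) W)) !linear_sum.
by apply: eq_bigr => p _; apply: fg.
Qed.

Lemma tensor_ext3r U V W X (f g : {linear tensor U (tensor V W) -> X}) :
  (forall u v w, f (u ⊗ (v ⊗ w)) = g (u ⊗ (v ⊗ w))) -> f =1 g.
Proof.
move=> fg; apply: tensor_ext => u x; rewrite [x]tensorE.
rewrite (linear_sumr (@tens K U (tensor V W))) !linear_sum.
by apply: eq_bigr => p _; apply: fg.
Qed.

Lemma tassocK U V W : cancel (@tassoc K U V W) (@tassocl U V W).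
Proof.
apply: (@tensor_ext3l U V W _ (@tassocl U V W \o @tassoc K U V W) idfun).
by move=> u v w; rewrite -[RHS]tassocl_tens -tassoc_tens.
Qed.

Lemma tassocl_tmap U V W U1 V1 W1 (f : {linear U -> U1}) (g : {linear V -> V1})
    (h : {linear W -> W1}) x :
  tassocl (tmap f (tmap g h) x) = tmap (tmap f g) h (tassocl x).
Proof.
move: x; apply: (@tensor_ext3r _ _ _ _ (@tassocl _ _ _ \o tmap f (tmap g h))
  (tmap (tmap f g) h \o @tassocl _ _ _)) => u v w.
change (tassocl (tmap f (tmap g h) (u ⊗ (v ⊗ w))) =
  tmap (tmap f g) h (tassocl (u ⊗ (v ⊗ w)))).
by rewrite !(tassocl_tens, tmap_tens) /= !tmap_tens tassocl_tens.
Qed.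

Lemma tassoc_tmap U V W U1 V1 W1 (f : {linear U -> U1}) (g : {linear V -> V1})
    (h : {linear W -> W1}) x :
  tassoc (tmap (tmap f g) h x) = tmap f (tmap g h) (tassoc x).
Proof.
move: x; apply: (@tensor_ext3l _ _ _ _ (@tassoc _ _ _ _ \o tmap (tmap f g) h)
  (tmap f (tmap g h) \o @tassoc _ _ _ _)) => u v w.
change (tassoc (tmap (tmap f g) h (u ⊗ v ⊗ w)) =
  tmap f (tmap g h) (tassoc (u ⊗ v ⊗ w))).
by rewrite !(tassoc_tens, tmap_tens) /= !tmap_tens tassoc_tens.
Qed.

Lemma tassocl_pentagon U V W X (x : tensor (tensor U V) (tensor W X)) :
  tassocl (tmap idfun (@tassocl V W X) (tassoc x)) =
  tmap (@tassoc K U V W) idfun (tassocl x).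
Proof.
move: x.
have H (u : U) (v : V) (w : W) (z : X) :
    tassocl (tmap idfun (@tassocl V W X) (tassoc ((u ⊗ v) ⊗ (w ⊗ z)))) =
  tmap (@tassoc K U V W) idfun (tassocl ((u ⊗ v) ⊗ (w ⊗ z))).
  rewrite !(tassocl_tens, tassoc_tens, tmap_tens) /=.
  by rewrite !(tassocl_tens, tassoc_tens, tmap_tens).
apply: (@tensor_ext3l _ _ _ _
  (@tassocl _ _ _ \o tmap idfun (@tassocl V W X) \o @tassoc _ _ _ _)
  (tmap (@tassoc K U V W) idfun \o @tassocl _ _ _)) => u v y.
rewrite [y]tensorE (linear_sumr (@tens K (tensor U V) (tensor W X))).
by rewrite !linear_sum; apply: eq_bigr => p _; apply: H.
Qed.

Section SplitLast.
Variable C : lmodType K.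

(** Tensor powers are bracketed to the right, so that their last factor is
    reached through successive reassociations. *)
Fixpoint tsplit_last n : {linear tpow C n.+1 -> tensor (tpow C n) C} :=
  if n is n'.+1 then @tassocl C (tpow C n') C \o tmap idfun (tsplit_last n')
  else idfun.

Lemma tsplit_last_insert (d : {linear C -> tensor C C}) n i x : (i <= n)%N ->
  tsplit_last n.+1 (tinsert d n.+1 i x) =
  tmap (tinsert d n i) idfun (tsplit_last n x).
Proof.
elim: n i x => [|n IHn] [|i] //= x lein.
- by rewrite tmap_id tassocK.
- transitivity (tassocl (tmap idfun
      (@tassocl C (tpow C n) C \o tmap idfun (tsplit_last n))
      (tassoc (tmap d idfun x)))); first by [].
  rewrite -(tmap_compr (@tassocl C (tpow C n) C) (tmap idfun (tsplit_last n))).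
  rewrite -tassoc_tmap tassocl_pentagon.
  transitivity (tmap (@tassoc _ C C (tpow C n) \o tmap d idfun) idfun
    (tassocl (tmap idfun (tsplit_last n) x))); last by [].
  rewrite -(tmap_compl (@tassoc _ C C (tpow C n)) (tmap d idfun)).
  rewrite -tassocl_tmap !tmap_comp; congr (tmap _ _ (tassocl _)).
  by apply: tmap_ext => y //=; rewrite !tmap_id.
- transitivity (tassocl (tmap idfun (tsplit_last n.+1)
                  (tmap idfun (tinsert d n.+1 i) x))); first by [].
  rewrite tmap_compr.
  rewrite (@tmap_ext _ _ _ _ _ idfun _
    (tmap (tinsert d n i) idfun \o tsplit_last n)) => [||y] //.
    rewrite -(tmap_compr (tmap (tinsert d n i) idfun) (tsplit_last n)).
    by rewrite tassocl_tmap.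
  exact: IHn.
Qed.

End SplitLast.

End TensorFacts.

(** * Bilinear maps *)

Section BilinearFacts.
Variable K : fieldType.
Implicit Types U V W X : lmodType K.

Definition bilin U V W (f : U -> V -> W)
    (fP : bilinear_for *:%R *:%R f) : {bilinear U -> V -> W} :=
  HB.pack f (bilinear_isBilinear.Build K U V W *:%R *:%R f fP).

Lemma bilinear_compr U V V1 W (m : U -> V -> W) (g : V1 -> V) :
  bilinear_for *:%R *:%R m -> linear g ->
  bilinear_for *:%R *:%R (fun u v => m u (g v)).
Proof.
by move=> [ml mr] gP; split=> [v c u u'|u c v v'] /=; rewrite ?gP (ml, mr).
Qed.

Lemma bilinear_compl U V U1 W (m : U -> V -> W) (g : U1 -> U) :
  bilinear_for *:%R *:%R m -> linear g ->
  bilinear_for *:%R *:%R (fun u v => m (g u) v).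
Proof.
by move=> [ml mr] gP; split=> [v c u u'|u c v v'] /=; rewrite ?gP (ml, mr).
Qed.

Lemma bilinear_add U V W (f g : U -> V -> W) :
  bilinear_for *:%R *:%R f -> bilinear_for *:%R *:%R g ->
  bilinear_for *:%R *:%R (fun u v => f u v + g u v).
Proof.
move=> [fl fr] [gl gr]; split=> [v c u u'|u c v v'] /=.
  by rewrite (fl v c) (gl v c) scalerDr addrACA.
by rewrite (fr u c) (gr u c) scalerDr addrACA.
Qed.

Lemma bilinear_flip U V W (f : U -> V -> W) :
  bilinear_for *:%R *:%R f -> bilinear_for *:%R *:%R (fun v u => f u v).
Proof. by move=> [fl fr]; split. Qed.

Lemma bilinear_tlift_param X U V W (f : X -> U -> V -> W) :
  (forall x, bilinear_for *:%R *:%R (f x)) ->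
  (forall u v (c : K) x y, f (c *: x + y) u v = c *: f x u v + f y u v) ->
  bilinear_for *:%R *:%R (fun x w => tlift (f x) w).
Proof.
move=> fP fl; split=> [w c x x'|x] /=; last exact: bilinear_tlift_linear.
by rewrite /tlift scaler_sumr -big_split; apply: eq_bigr => p _; apply: fl.
Qed.

Lemma bilinear_tlift2 U V U1 V1 W (f : U -> V -> U1 -> V1 -> W) :
  (forall u v, bilinear_for *:%R *:%R (f u v)) ->
  (forall u1 v1, bilinear_for *:%R *:%R (fun u v => f u v u1 v1)) ->
  bilinear_for *:%R *:%R (fun w z => \tsum_(u, v <- w) (tlift (f u v) z)).
Proof.
move=> fP fQ; apply: bilinear_flip.
apply: bilinear_tlift_param => [z|u v]; last exact: bilinear_tlift_linear.
split=> [v c u u'|u c v v'] /=;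
  rewrite /tlift scaler_sumr -big_split; apply: eq_bigr => p _ /=.
  exact: (fQ _ _).1.
exact: (fQ _ _).2.
Qed.

End BilinearFacts.

(** * Maps that factor through iterated coproducts *)

Section ThroughCoproducts.
Variables (K : fieldType) (C : lmodType K).
Variables (Dprec Dsucc : {linear C -> tensor C C}).

Local Notation iterated n := (@iterated_coproducts K C Dprec Dsucc n).

(** The linear span of the maps l o P, with P an n-fold coproduct.  Unlike the
    subspace killed by the n-fold coproducts, it is visibly compatible with
    convolution, without any computation of kernels of tensor products of
    maps. *)
Inductive through_coproducts n (W : lmodType K) : (C -> W) -> Prop :=
| through_iterated (l : {linear tpow C n -> W}) (P : C -> tpow C n) :
    iterated n P -> through_coproducts n (l \o P)
| throughD f g : through_coproducts n f -> through_coproducts n g ->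
    through_coproducts n (fun a => f a + g a).

Lemma through_ext n (W : lmodType K) (f g : C -> W) :
  f =1 g -> through_coproducts n f -> through_coproducts n g.
Proof. by move=> /funext ->. Qed.

Lemma through_comp n (W W1 : lmodType K) (l : {linear W -> W1}) (f : C -> W) :
  through_coproducts n f -> through_coproducts n (l \o f).
Proof.
elim=> [k P hP|f1 f2 _ IH1 _ IH2]; first exact: (through_iterated (l \o k) hP).
by apply: through_ext (throughD IH1 IH2) => a /=; rewrite linearD.
Qed.

Lemma through_vanish n (W : lmodType K) (f : C -> W) a :
  (forall P, iterated n P -> P a = 0) ->
  through_coproducts n f -> f a = 0.
Proof.
move=> Pa; elim=> [l P hP|f1 f2 _ -> _ ->]; last by rewrite addr0.
by rewrite /= Pa // linear0.
Qed.

Lemma iterated_vanish_leq n k a : (n <= k)%N ->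
  (forall P, iterated n P -> P a = 0) ->
  forall P, iterated k P -> P a = 0.
Proof.
move=> /subnK <-; elim: (k - n)%N => // j IHj /IHj Pa P [Q [i [d [hQ _ ->]]]].
by rewrite /= Pa // linear0.
Qed.

(** An n-fold coproduct applied to the right factor of d is an (n+1)-fold one,
    in which every index of insertion is shifted by one. *)
Lemma iterated_right n (P : C -> tpow C n) (d : {linear C -> tensor C C}) :
  iterated n P -> d = Dprec \/ d = Dsucc ->
  exists2 Q : C -> tpow C n.+1, iterated n.+1 Q &
    forall a, \tsum_(u, v <- d a) (u ⊗ P v) = Q a.
Proof.
move=> hP hd; elim: n P hP => [|n IHn] P /=.
  move=> ->; exists d; last by move=> a; exact: tlift_id.
  by exists id, ord0, d; split.
move=> [Q [i [e [hQ he ->]]]]; have [R hR QR] := IHn _ hQ.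
exists (tinsert e n.+1 (lift ord0 i) \o R).
  by exists R, (lift ord0 i), e; split.
move=> a; rewrite /= -QR /tmap.
transitivity (tmap idfun (tinsert e n i) (\tsum_(u, v <- d a) (u ⊗ Q v))).
  rewrite (tlift_comp (tmap idfun (tinsert e n i))).
  by apply: eq_tlift => u v; rewrite /= tmap_tens.
by [].
Qed.

(** On the left factor the indices of insertion do not change, but the result
    has to be rebracketed. *)
Lemma iterated_left n (P : C -> tpow C n) (d : {linear C -> tensor C C}) :
  iterated n P -> d = Dprec \/ d = Dsucc ->
  exists2 Q : C -> tpow C n.+1, iterated n.+1 Q &
    forall a, \tsum_(u, v <- d a) (P u ⊗ v) = tsplit_last C n (Q a).
Proof.
move=> hP hd; elim: n P hP => [|n IHn] P.
  move=> ->; exists d; last by move=> a; exact: tlift_id.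
  by exists id, ord0, d; split.
move=> [Q [i [e [hQ he ->]]]]; have [R hR QR] := IHn _ hQ.
exists (tinsert e n.+1 i \o R).
  by exists R, (widen_ord (leqnSn _) i), e; split.
have lein : (i <= n)%N by rewrite -ltnS.
move=> a; transitivity (tmap (tinsert e n i) idfun (tsplit_last C n (R a))).
  rewrite -QR (tlift_comp (tmap (tinsert e n i) idfun)).
  by apply: eq_tlift => u v; rewrite /= tmap_tens.
exact/esym/tsplit_last_insert.
Qed.

Definition coproduct (d : C -> tensor C C) :=
  [\/ d = Dprec, d = Dsucc | d = Dprec \+ Dsucc].

Lemma through_linear n (W : lmodType K) (f : C -> W) :
  through_coproducts n f -> linear f.
Proof.
elim=> [l P hP|f1 f2 _ IH1 _ IH2] c a b /=; last first.
  by rewrite IH1 IH2 scalerDr addrACA.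
rewrite -linearP; congr (l _).
elim: n P hP {l} => [|n IHn] P /=; first by move=> ->.
by move=> [Q [i [d [hQ _ ->]]]] /=; rewrite IHn // linearP.
Qed.

(** Convolution with a map that factors through n-fold coproducts uses one more
    coproduct.  For D this holds because D is the sum of Dprec and Dsucc. *)
Lemma through_right n (V W : lmodType K) (m : C -> V -> W) (f : C -> V) d :
  bilinear_for *:%R *:%R m -> coproduct d -> through_coproducts n f ->
  through_coproducts n.+1 (fun a => \tsum_(u, v <- d a) (m u (f v))).
Proof.
move=> mP hd hf; have fP := through_linear hf.
have base (e : {linear C -> tensor C C}) : e = Dprec \/ e = Dsucc ->
    through_coproducts n.+1 (fun a => \tsum_(u, v <- e a) (m u (f v))).
  move=> he; elim: hf => [l P hP|f1 f2 _ IH1 _ IH2].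
    have [Q hQ PQ] := iterated_right hP he.
    have mlP := bilinear_compr mP (linearP l).
    pose l1 : {linear tpow C n.+1 -> W} := tlin mlP.
    apply: through_ext (through_iterated l1 hQ) => a /=.
    rewrite -PQ -[LHS]/(tlin mlP _) tlift_comp; apply: eq_tlift => u v.
    exact: (bilinear_tlift_tens mlP).
  apply: through_ext (throughD IH1 IH2) => a.
  rewrite -tlift_split; apply: eq_tlift => u v.
  exact/esym/(linearDr (bilin mP)).
case: hd => ->; [by apply: base; left | by apply: base; right |].
have mfP := bilinear_compr mP fP.
apply: through_ext (throughD (base Dprec _) (base Dsucc _)) => [a||]; auto.
exact/esym/(linearD (tlin mfP)).
Qed.

Lemma through_left n (U W : lmodType K) (m : U -> C -> W) (f : C -> U) d :
  bilinear_for *:%R *:%R m -> coproduct d -> through_coproducts n f ->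
  through_coproducts n.+1 (fun a => \tsum_(u, v <- d a) (m (f u) v)).
Proof.
move=> mP hd hf; have fP := through_linear hf.
have base (e : {linear C -> tensor C C}) : e = Dprec \/ e = Dsucc ->
    through_coproducts n.+1 (fun a => \tsum_(u, v <- e a) (m (f u) v)).
  move=> he; elim: hf => [l P hP|f1 f2 _ IH1 _ IH2].
    have [Q hQ PQ] := iterated_left hP he.
    have mlP := bilinear_compl mP (linearP l).
    pose l1 : {linear tpow C n.+1 -> W} := tlin mlP \o tsplit_last C n.
    apply: through_ext (through_iterated l1 hQ) => a /=.
    rewrite -PQ -[LHS]/(tlin mlP _) tlift_comp; apply: eq_tlift => u v.
    exact: (bilinear_tlift_tens mlP).
  apply: through_ext (throughD IH1 IH2) => a.
  rewrite -tlift_split; apply: eq_tlift => u v.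
  exact/esym/(linearDl (bilin mP)).
case: hd => ->; [by apply: base; left | by apply: base; right |].
have mfP := bilinear_compl mP fP.
apply: through_ext (throughD (base Dprec _) (base Dsucc _)) => [a||]; auto.
exact/esym/(linearD (tlin mfP)).
Qed.

Hypothesis hconn : dendriform_connected Dprec Dsucc.

(** Iterating the equation shows that f factors through n-fold coproducts for
    every n. *)
Lemma convolution_unique (W : lmodType K) (m : C -> W -> W)
    (f : {linear C -> W}) d :
  bilinear_for *:%R *:%R m -> coproduct d ->
  (forall a, f a = \tsum_(u, v <- d a) (m u (f v))) -> forall a, f a = 0.
Proof.
move=> mP hd fE a; have [n Pa] := hconn a; apply: (through_vanish Pa).
elim: n {Pa} => [|n IHn].
  exact: (@through_iterated 0 W f id).
by apply: through_ext (through_right mP hd IHn) => b; rewrite -fE.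
Qed.

(** The Picard iterates from 0 are stationary at each point, because the
    difference of two successive ones, T_(k+1) - T_k, factors through k-fold
    coproducts. *)
Lemma convolution_exists (W : lmodType K) (m : C -> W -> W)
    (g : {linear C -> W}) (d : {linear C -> tensor C C}) :
  bilinear_for *:%R *:%R m -> coproduct d ->
  exists T : {linear C -> W},
    forall a, T a = g a - \tsum_(u, v <- d a) (m u (T v)).
Proof.
move=> mP hd.
pose F (f : C -> W) a := g a - \tsum_(u, v <- d a) (m u (f v)).
pose T k := iter k F (fun=> 0).
have Tlin k : linear (T k).
  elim: k => [|k IHk] c a b; first by rewrite /= scaler0 addr0.
  have mTP := bilinear_compr mP IHk.
  have tP := linearP (tlin mTP); rewrite /= in tP.
  by rewrite /= /F !linearP tP scalerBr opprD addrACA.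
have TS k : through_coproducts k (fun a => T k.+1 a - T k a).
  elim: k => [|k IHk].
    apply: through_ext (@through_iterated 0 W g id (erefl _)) => a.
    rewrite /= /F subr0 [X in _ - X](_ : _ = 0) ?subr0 //.
    by apply: big1 => p _; exact: (linear0r (bilin mP)).
  apply: through_ext (through_comp (-%R) (through_right mP hd IHk)) => a /=.
  transitivity (F (T k.+1) a - F (T k) a); last by [].
  rewrite /F opprB addrC subrKA -tlift_sub -[LHS]tlift_opp; apply: eq_tlift => u v.
  have mB := linearBr (bilin mP); rewrite /= in mB.
  by rewrite mB opprB.
have [n Pn] := choice hconn.
have Tn k a : (n a <= k)%N -> T k a = T (n a) a.
  move=> /subnK <-; elim: (k - n a)%N => // j <-.
  apply/eqP; rewrite -subr_eq0; apply/eqP; rewrite addSn.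
  exact: (through_vanish (iterated_vanish_leq (leq_addl _ _) (@Pn a)) (TS _)).
have Tinf k a : (n a <= k)%N -> T (n a) a = T k a by move/Tn.
have TP : linear (fun a => T (n a) a).
  move=> c a b.
  pose k := (n (c *: a + b)%R + (n a + n b))%N.
  rewrite !(Tinf k) ?Tlin // /k; lia.
pose T1 : {linear C -> W} := HB.pack (fun a => T (n a) a)
  (GRing.isLinear.Build _ _ _ _ (fun a => T (n a) a) TP).
exists T1 => a /=.
(* The implicit sum has finitely many terms, so that one index k is large
   enough for a and for the right factors of all of them. *)
pose k := (n a + \sum_(p <- repr (d a)) n p.2)%N.
rewrite (Tinf k.+1) ?leqW ?leq_addr // /= /F; congr (_ - _).
rewrite /tlift !big_seq; apply: eq_bigr => p pa.
by rewrite (Tinf k p.2) // /k (big_rem p) //= addnCA leq_addr.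
Qed.

End ThroughCoproducts.

(** * Coproducts of products *)

Section Bidendriform.
Variables (K : fieldType) (A : lmodType K).
Variables (prec succ : {bilinear A -> A -> A}).
Variables (Dprec Dsucc : {linear A -> tensor A A}).

Local Notation "a ≺ b" := (prec a b) (at level 35).
Local Notation "a ≻ b" := (succ a b) (at level 35).
Local Notation D := (Dprec \+ Dsucc).

Definition dmul a b := a ≺ b + a ≻ b.

Fact dmul_is_bilinear : bilinear_for *:%R *:%R dmul.
Proof.
apply: bilinear_add; split=> [v c u u'|u c v v'] /=.
- by rewrite linearPl.
- by rewrite linearPr.
- by rewrite linearPl.
- by rewrite linearPr.
Qed.

HB.instance Definition _ := bilinear_isBilinear.Build K A A A *:%R *:%R
  dmul dmul_is_bilinear.

Definition cross (m : {bilinear A -> A -> A}) (w z : tensor A A) : tensor A A :=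
  \tsum_(a1, a2 <- w) (\tsum_(b1, b2 <- z) (dmul a1 b1 ⊗ m a2 b2)).

Ltac bilinearity := by split=> [? ? ? ?|? ? ? ?] /=; rewrite !(linearPl, linearPr).

Fact cross_is_bilinear m : bilinear_for *:%R *:%R (cross m).
Proof. by apply: bilinear_tlift2 => ? ?; bilinearity. Qed.

HB.instance Definition _ m := bilinear_isBilinear.Build K (tensor A A)
  (tensor A A) (tensor A A) *:%R *:%R (cross m) (cross_is_bilinear m).

(** The part of Dsucc (u ≻ b) that depends linearly on w = Dsucc b, as well as
    the whole of Dprec (u ≻ b) for w = Dprec b.  It is the product of
    u ⊗ 1 + 1 ⊗ u + D u with w, for the associative product on the left factor
    and ≻ on the right factor, where 1 ≻ b = b. *)
Definition act_succ (u : A) (w : tensor A A) : tensor A A :=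
  cross succ (D u) w + \tsum_(b1, b2 <- w) (dmul u b1 ⊗ b2)
  + \tsum_(b1, b2 <- w) (b1 ⊗ (u ≻ b2)).

(** The part of D (a ≺ u) that depends linearly on w = D a. It is the product of
    w with u ⊗ 1 + 1 ⊗ u + D u, for the associative product on the left factor
    and ≺ on the right factor, where a ≺ 1 = a. *)
Definition act_prec (u : A) (w : tensor A A) : tensor A A :=
  cross prec w (D u) + \tsum_(a1, a2 <- w) (dmul a1 u ⊗ a2)
  + \tsum_(a1, a2 <- w) (a1 ⊗ (a2 ≺ u)).

Lemma act_succ_is_bilinear : bilinear_for *:%R *:%R act_succ.
Proof.
apply: bilinear_add; first apply: bilinear_add.
- exact: (bilinear_compl (cross_is_bilinear succ) (linearP D)).
- apply: bilinear_tlift_param => [?|? ? ? ? ?] /=; first bilinearity.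
  by rewrite (linearPl dmul) linearPl.
- apply: bilinear_tlift_param => [?|? ? ? ? ?] /=; first bilinearity.
  by rewrite linearPl linearPr.
Qed.

Lemma act_prec_is_bilinear : bilinear_for *:%R *:%R act_prec.
Proof.
apply: bilinear_add; first apply: bilinear_add.
- apply: bilinear_flip.
  exact: (bilinear_compr (cross_is_bilinear prec) (linearP D)).
- apply: bilinear_tlift_param => [?|? ? ? ? ?] /=; first bilinearity.
  by rewrite (linearPr dmul) linearPl.
- apply: bilinear_tlift_param => [?|? ? ? ? ?] /=; first bilinearity.
  by rewrite !linearPr.
Qed.

Fact tens_prec_is_bilinear a :
  bilinear_for *:%R *:%R (fun u v : A => u ⊗ (a ≺ v)).
Proof. bilinearity. Qed.

Hypothesis hA : bidendriform_bialgebra prec succ Dprec Dsucc.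

Lemma Dsucc_succ a b : Dsucc (a ≻ b) =
  act_succ a (Dsucc b) + \tsum_(u, v <- D a) (u ⊗ (v ≻ b)) + a ⊗ b.
Proof.
rewrite (bidend_Dsucc_succ hA a b) /=; congr (_ + _).
by rewrite [LHS](ACl (1 * 4 * 3 * 2)).
Qed.

Lemma Dprec_succ a b : Dprec (a ≻ b) = act_succ a (Dprec b).
Proof. exact: bidend_Dprec_succ. Qed.

Lemma Dprec_prec a b : Dprec (a ≺ b) =
  cross prec (D a) (Dprec b) + \tsum_(u, v <- D a) (dmul u b ⊗ v) +
  \tsum_(u, v <- Dprec b) (u ⊗ (a ≺ v)) + b ⊗ a.
Proof. exact: bidend_Dprec_prec. Qed.

Lemma Dsucc_prec a b : Dsucc (a ≺ b) =
  cross prec (D a) (Dsucc b) + \tsum_(u, v <- D a) (u ⊗ (v ≺ b)) +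
  \tsum_(u, v <- Dsucc b) (u ⊗ (a ≺ v)).
Proof. exact: bidend_Dsucc_prec. Qed.

Lemma D_prec a b : D (a ≺ b) =
  act_prec b (D a) + \tsum_(u, v <- D b) (u ⊗ (a ≺ v)) + b ⊗ a.
Proof.
have lP := linearD (tlin (tens_prec_is_bilinear a)); rewrite /= in lP.
rewrite [LHS]/= Dprec_prec Dsucc_prec /act_prec [in RHS]lP.
rewrite [D b]/= (linearDr (cross prec)) /=.
by rewrite !addrA [LHS](ACl (1 * 5 * 2 * 6 * 3 * 7 * 4)).
Qed.

Lemma Dprec_prec_prim a b : D a = 0 ->
  Dprec (a ≺ b) = \tsum_(u, v <- Dprec b) (u ⊗ (a ≺ v)) + b ⊗ a.
Proof.
move=> Da; rewrite Dprec_prec Da (linear0l (cross prec)).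
rewrite -[\tsum_(_, _ <- 0) _]/(tmap (applyr dmul b) idfun 0) linear0.
by rewrite !add0r.
Qed.

Lemma Dsucc_prec_prim a b : D a = 0 ->
  Dsucc (a ≺ b) = \tsum_(u, v <- Dsucc b) (u ⊗ (a ≺ v)).
Proof.
move=> Da; rewrite Dsucc_prec Da (linear0l (cross prec)).
rewrite -[\tsum_(_, _ <- 0) _]/(tmap idfun (applyr prec b) 0) linear0.
by rewrite !add0r.
Qed.

(** * Projections onto primitive elements *)

Let codend := bidend_coalgebra hA.

(** Coassociativity of the total coproduct is the sum of the three axioms of a
    dendriform coalgebra. *)
Lemma codend_total c : tassoc (tmap D idfun (D c)) = tmap idfun D (D c).
Proof.
have tDl (f g : {linear A -> tensor A A}) x :
    tmap (f \+ g) (idfun : {linear A -> A}) x = tmap f idfun x + tmap g idfun x.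
  rewrite -tlift_split; apply: eq_tlift => u v.
  by rewrite /tmap_fun /= linearDl.
have tDr (f g : {linear A -> tensor A A}) x :
    tmap (idfun : {linear A -> A}) (f \+ g) x = tmap idfun f x + tmap idfun g x.
  rewrite -tlift_split; apply: eq_tlift => u v.
  by rewrite /tmap_fun /= linearDr.
transitivity (tassoc (tmap D idfun (Dprec c)) + tassoc (tmap D idfun (Dsucc c))).
  by rewrite -linearD -(linearD (tmap D idfun)).
transitivity (tmap idfun D (Dprec c) + tmap idfun D (Dsucc c)); last first.
  by rewrite -(linearD (tmap idfun D)).
rewrite (codend_succ_succ codend) tDl linearD /=.
rewrite (codend_prec_prec codend).
by rewrite (codend_succ_prec codend) -addrA -tDr.
Qed.

Lemma linear_sub_tlift (W : lmodType K) (l : {linear A -> W}) a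
    (f : A -> A -> A) (x : tensor A A) :
  l (a - tlift f x) = l a - \tsum_(u, v <- x) (l (f u v)).
Proof. by rewrite linearB tlift_comp. Qed.

(** The common shape of the uses of coassociativity below: the inner coproduct
    moves from the left to the right factor, where p turns it into a known
    map g. *)
Lemma tlift_regroup (d d' : {linear A -> tensor A A}) (x y : tensor A A)
    (p : A -> A -> A) (g : A -> A) :
  bilinear_for *:%R *:%R p ->
  tassoc (tmap d idfun x) = tmap idfun d' y ->
  (forall c, tlift p (d' c) = g c) ->
  \tsum_(u, v <- x) (\tsum_(u1, u2 <- d u) (u1 ⊗ p u2 v)) =
  \tsum_(u, v <- y) (u ⊗ g v).
Proof.
move=> pP dxy pg; transitivity (tmap idfun (tlin pP) (tassoc (tmap d idfun x))).
  rewrite -tlift_coassoc; apply: eq_tlift => u v; apply: eq_tlift => u1 u2 /=.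
  by rewrite (bilinear_tlift_tens pP).
by rewrite dxy tmap_compr; apply: eq_tlift => u v; rewrite /tmap_fun /= pg.
Qed.

Hypothesis hconn : dendriform_connected Dprec Dsucc.

(** By coassociativity, the terms of D (pi(a'') ≺ a') in which pi(a'') is not
    itself cut add up to D a.  What remains is
    D pi(a) = - act_prec a' (D pi(a'')), an equation whose only solution
    is 0. *)
Lemma prim_projection : exists pi : {linear A -> A},
  forall a, D (pi a) = 0 /\ pi a = a - \tsum_(u, v <- D a) (pi v ≺ u).
Proof.
have precP : bilinear_for *:%R *:%R (fun u v : A => v ≺ u) by bilinearity.
have hD : coproduct Dprec Dsucc D by apply: Or33.
have [pi piE] := convolution_exists hconn (d := D) idfun precP hD.
have piprecP := bilinear_compr precP (linearP pi).
exists pi => a; split; last exact: piE.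
move: a; apply: (convolution_unique hconn (f := D \o pi)
  (m := fun u w => - act_prec u w) _ hD).
  have [l r] := act_prec_is_bilinear.
  split=> [w c u u'|u c w w'] /=; first by rewrite (l w c) scalerN opprD.
  by rewrite (r u c) scalerN opprD.
move=> a; transitivity (D a - \tsum_(u, v <- D a) (D (pi v ≺ u))).
  by rewrite [LHS]/(D (pi a)) piE; exact: (linear_sub_tlift D).
rewrite [RHS]tlift_opp -[RHS]sub0r -(subrr (D a)) -[RHS]addrA -opprD.
congr (_ - _).
transitivity (\tsum_(u, v <- D a) (u ⊗ (v - pi v) + u ⊗ pi v) +
              \tsum_(u, v <- D a) (act_prec u (D (pi v)))).
  have reg : \tsum_(u, v <- D a) (\tsum_(u1, u2 <- D u) (u1 ⊗ (pi v ≺ u2))) =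
      \tsum_(u, v <- D a) (u ⊗ (v - pi v)).
    apply: (tlift_regroup (g := fun v => v - pi v) piprecP (codend_total a)) => c.
    by rewrite piE opprB addrCA subrr addr0.
  rewrite [X in _ = X + _]tlift_split -reg -!tlift_split; apply: eq_tlift => u v.
  by rewrite D_prec [LHS](ACl (2 * 3 * 1)).
congr (_ + _); rewrite -[RHS]tlift_id; apply: eq_tlift => u v.
by rewrite -linearDr subrK.
Qed.

(** Since pi(a'') is killed by D, both coproducts of pi(a''_prec) ≺ a'_prec only
    involve coproducts of a'_prec, and the first two dendriform axioms carry
    these over to a''. *)
Lemma Dprec_projection (pi : {linear A -> A}) :
  (forall a, D (pi a) = 0 /\ pi a = a - \tsum_(u, v <- D a) (pi v ≺ u)) ->
  exists e : {linear A -> A}, forall a,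
    [/\ e a = a - \tsum_(u, v <- Dprec a) (pi v ≺ u), Dprec (e a) = 0
      & Dsucc (e a) = \tsum_(u, v <- Dsucc a) (u ⊗ e v)].
Proof.
move=> piP.
have precP : bilinear_for *:%R *:%R (fun u v : A => pi v ≺ u).
  by apply: (bilinear_compr (m := fun u v : A => v ≺ u) _ (linearP pi)); bilinearity.
have piE c : \tsum_(u, v <- D c) (pi v ≺ u) = c - pi c.
  by rewrite [in RHS](piP c).2 opprB addrCA subrr addr0.
exists (idfun \- (tlin precP \o Dprec)) => a; split=> //=.
  rewrite linear_sub_tlift; apply/eqP; rewrite subr_eq0; apply/eqP.
  transitivity (\tsum_(u, v <- Dprec a) (u ⊗ (v - pi v) + u ⊗ pi v)).
    rewrite -[LHS]tlift_id; apply: eq_tlift => u v.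
    by rewrite -linearDr subrK.
  have reg : \tsum_(u, v <- Dprec a)
        (\tsum_(u1, u2 <- Dprec u) (u1 ⊗ (pi v ≺ u2))) =
      \tsum_(u, v <- Dprec a) (u ⊗ (v - pi v)).
    exact: (tlift_regroup (g := fun v => v - pi v) precP
              (codend_prec_prec codend a)).
  rewrite tlift_split -reg -!tlift_split; apply: eq_tlift => u v.
  by rewrite Dprec_prec_prim // (piP v).1.
rewrite linear_sub_tlift.
rewrite (eq_tlift (g := fun u v =>
  \tsum_(u1, u2 <- Dsucc u) (u1 ⊗ (pi v ≺ u2)))) => [|u v]; last first.
  by rewrite Dsucc_prec_prim // (piP v).1.
rewrite (tlift_regroup precP (codend_succ_prec codend a) (fun=> erefl)).
rewrite -[X in X - _]tlift_id -tlift_sub; apply: eq_tlift => u v.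
by rewrite linearBr.
Qed.

(** Both Dprec theta and Dsucc theta satisfy the homogeneous equation
    f(a) = - act_succ a'_succ (f(a''_succ)): for Dprec because Dprec e = 0, for
    Dsucc because the remaining terms cancel by the third dendriform axiom. *)
Lemma prim_tot_projection (e : {linear A -> A}) :
  (forall a, Dprec (e a) = 0
             /\ Dsucc (e a) = \tsum_(u, v <- Dsucc a) (u ⊗ e v)) ->
  exists theta : {linear A -> A}, forall a,
    [/\ theta a = e a - \tsum_(u, v <- Dsucc a) (u ≻ theta v),
        Dprec (theta a) = 0 & Dsucc (theta a) = 0].
Proof.
move=> eP.
have succP : bilinear_for *:%R *:%R (fun u v : A => u ≻ v) by bilinearity.
have hD : coproduct Dprec Dsucc Dsucc by apply: Or32.
have [th thE] := convolution_exists hconn (d := Dsucc) e succP hD.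
have thP := bilinear_compr succP (linearP th).
have actP : bilinear_for *:%R *:%R (fun u w => - act_succ u w).
  have [l r] := act_succ_is_bilinear.
  split=> [w c u u'|u c w w'] /=; first by rewrite (l w c) scalerN opprD.
  by rewrite (r u c) scalerN opprD.
have Dprec0 : forall a, Dprec (th a) = 0.
  apply: (convolution_unique hconn (f := Dprec \o th) actP hD) => a.
  transitivity (Dprec (e a - \tsum_(u, v <- Dsucc a) (u ≻ th v))).
    exact: (congr1 Dprec (thE a)).
  rewrite linear_sub_tlift (eP a).1 sub0r.
  rewrite [RHS]tlift_opp; congr (- _); apply: eq_tlift => u v.
  exact: Dprec_succ.
exists th => a; split=> //.
move: a; apply: (convolution_unique hconn (f := Dsucc \o th) actP hD) => a.
transitivity (Dsucc (e a - \tsum_(u, v <- Dsucc a) (u ≻ th v))).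
  exact: (congr1 Dsucc (thE a)).
rewrite linear_sub_tlift (eP a).2.
rewrite [RHS]tlift_opp -[RHS]sub0r.
rewrite -(subrr (\tsum_(u, v <- Dsucc a) (u ⊗ e v))) -[RHS]addrA -opprD.
congr (_ - _).
transitivity (\tsum_(u, v <- Dsucc a) (u ⊗ (e v - th v) + u ⊗ th v) +
              \tsum_(u, v <- Dsucc a) (act_succ u (Dsucc (th v)))).
  have reg : \tsum_(u, v <- Dsucc a) (\tsum_(u1, u2 <- D u) (u1 ⊗ (u2 ≻ th v))) =
      \tsum_(u, v <- Dsucc a) (u ⊗ (e v - th v)).
    apply: (tlift_regroup (g := fun v => e v - th v) thP
              (codend_succ_succ codend a)) => c.
    by rewrite thE opprB addrCA subrr addr0.
  rewrite [X in _ = X + _]tlift_split -reg -!tlift_split; apply: eq_tlift => u v.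
  by rewrite Dsucc_succ [LHS](ACl (2 * 3 * 1)).
congr (_ + _); apply: eq_tlift => u v.
by rewrite -linearDr subrK.
Qed.

(** * Generation by the totally primitive elements *)

Section Generation.
Variables (S : set A) (hS : dendriform_subalgebra prec succ S).
Hypothesis primS : (prim_tot Dprec Dsucc `<=` S)%classic.

Lemma dendsubD a b : S a -> S b -> S (a + b).
Proof. by rewrite -[a in a + b]scale1r; exact: (dendsubP hS). Qed.

Lemma dendsub_tlift (f : A -> A -> A) (x : tensor A A) :
  (forall u v, S (f u v)) -> S (tlift f x).
Proof.
move=> fS; apply: big_ind => //; first exact: dendsub0 hS.
exact: dendsubD.
Qed.

Local Notation through n f := (through_coproducts Dprec Dsucc n f).

(** Phi_(n+1) and psi_(n+1) are the right-hand sides of the two equations, in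
    which Phi_n and psi_n replace Id and pi.  The map psi is needed along with
    Phi because membership of pi(a) in S is not known beforehand. *)
Lemma subalgebra_approximation (pi th : {linear A -> A}) :
  (forall a, pi a = a - \tsum_(u, v <- D a) (pi v ≺ u)) ->
  (forall a, a = th a + \tsum_(u, v <- Dsucc a) (u ≻ th v)
                 + \tsum_(u, v <- Dprec a) (pi v ≺ u)) ->
  (forall a, S (th a)) ->
  forall n, exists Phi psi : {linear A -> A},
    [/\ forall a, S (Phi a), forall a, S (psi a),
        through n (fun a => a - Phi a) & through n (fun a => pi a - psi a)].
Proof.
move=> piE decomp thS; elim=> [|n [Phi [psi [PhiS psiS hPhi hpsi]]]].
  exists (\0 : {linear A -> A}), (\0 : {linear A -> A}); split=> [a|a||].
  - exact: dendsub0 hS.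
  - exact: dendsub0 hS.
  - apply: through_ext (@through_iterated _ _ Dprec Dsucc 0 A idfun id erefl).
    by move=> a /=; rewrite subr0.
  - apply: through_ext (@through_iterated _ _ Dprec Dsucc 0 A pi id erefl).
    by move=> a /=; rewrite subr0.
have precP : bilinear_for *:%R *:%R (fun u v : A => v ≺ u) by bilinearity.
have succP : bilinear_for *:%R *:%R (fun u v : A => u ≻ v) by bilinearity.
have thP := bilinear_compr succP (linearP th).
have psiP := bilinear_compr precP (linearP psi).
have pP := bilinear_compl psiP (linearP Phi).
have sP := bilinear_compl thP (linearP Phi).
(* Replacing both factors of pi(v) ≺ u costs one error term for each factor. *)
have error d : coproduct Dprec Dsucc d -> through n.+1
    (fun a => \tsum_(u, v <- d a) (pi v ≺ u)
              - \tsum_(u, v <- d a) (psi v ≺ Phi u)).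
  move=> hd.
  apply: through_ext (throughD (through_right precP hd hpsi)
                               (through_left psiP hd hPhi)) => a.
  rewrite -tlift_split -tlift_sub; apply: eq_tlift => u v.
  by rewrite linearBl linearBr /= addrA subrK.
pose Phi1 : {linear A -> A} := th \+ (tlin sP \o Dsucc) \+ (tlin pP \o Dprec).
pose psi1 : {linear A -> A} := Phi1 \- (tlin pP \o D).
have hPhi1 : through n.+1 (fun a => a - Phi1 a).
  apply: through_ext (throughD (through_left thP (Or32 _ _ erefl) hPhi)
                               (error Dprec (Or31 _ _ erefl))) => a.
  rewrite [X in _ = X - _](decomp a) /= !opprD !addrA.
  rewrite [RHS](ACl ((1 * 4) * (2 * 5) * 3 * 6)) /= subrr add0r.
  congr (_ + _ - _).
  rewrite -tlift_sub; apply: eq_tlift => u v.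
  by rewrite linearBl.
exists Phi1, psi1.
have Phi1S a : S (Phi1 a).
  apply: dendsubD; first apply: dendsubD.
  - exact: thS.
  - by apply: dendsub_tlift => u v; apply: (dendsub_succ hS).
  - by apply: dendsub_tlift => u v; apply: (dendsub_prec hS).
split; first exact: Phi1S.
- move=> a; rewrite /= addrC -scaleN1r; apply: (dendsubP hS); last exact: Phi1S.
  by apply: dendsub_tlift => u v; apply: (dendsub_prec hS).
- exact: hPhi1.
- have herr := through_comp (-%R : {linear A -> A}) (error D (Or33 _ _ erefl)).
  apply: through_ext (throughD hPhi1 herr) => a.
  rewrite [X in _ = X - _]piE.
  rewrite -[psi1 a]/(Phi1 a - \tsum_(u, v <- D a) (psi v ≺ Phi u)).
  rewrite -[LHS]/(a - Phi1 a - (\tsum_(u, v <- D a) (pi v ≺ u)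
                                - \tsum_(u, v <- D a) (psi v ≺ Phi u))).
  by rewrite !opprB addrACA [RHS]addrACA; congr (_ + _); rewrite addrC.
Qed.

Lemma generated_by_prim_tot a : S a.
Proof.
have [pi piP] := prim_projection.
have [e eP] := Dprec_projection piP.
have [b|th thP] := @prim_tot_projection e; first by have [] := eP b.
have decomp b : b = th b + \tsum_(u, v <- Dsucc b) (u ≻ th v)
                   + \tsum_(u, v <- Dprec b) (pi v ≺ u).
  have [thE _ _] := thP b; have [eE _ _] := eP b.
  by rewrite thE subrK eE subrK.
have thS b : S (th b) by have [_ ? ?] := thP b; apply: primS.
have [n vanish] := hconn a.
have [Phi [_ [PhiS _ hPhi _]]] :=
  subalgebra_approximation (fun b => (piP b).2) decomp thS n.
move: (through_vanish vanish hPhi) => /eqP; rewrite subr_eq0 => /eqP ->.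
exact: PhiS.
Qed.

End Generation.

End Bidendriform.

Unset Implicit Arguments.

Theorem theorem21 (K : fieldType) (A : lmodType K)
    (prec succ : {bilinear A -> A -> A})
    (Dprec Dsucc : {linear A -> tensor A A})
    (hA : bidendriform_bialgebra prec succ Dprec Dsucc)
    (hconn : dendriform_connected Dprec Dsucc) :
  smallest (dendriform_subalgebra prec succ) (prim_tot Dprec Dsucc) = setT.
Proof.
apply/seteqP; split=> // a _ S [hS primS].
exact: (generated_by_prim_tot hA hconn hS primS).
Qed.
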